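(* There exists an expansion (universal finite type invariant) $Z\colon\{\text{long w-knots}\}\to\mathcal{A}^{sw}(\uparrow)$; that is, an invariant $Z$ of long w-knots with values in $\mathcal{A}^{sw}(\uparrow)$ such that for every $m\ge0$ and every $m$-singular long w-knot $K$ with underlying arrow diagram $D$ (of degree $m$), $Z(K)=D+(\text{terms of degree}>m)$.
   Context: **Long w-knots.** A long v-knot diagram is encoded by a Gauss diagram: an oriented line (''skeleton'') with finitely many arrows whose endpoints are distinct points of the line, each carrying a sign $\pm$, considered up to orientation-preserving diffeomorphism of the line. Each crossing gives one arrow, from its over strand (tail) to its under strand (head), with the sign of the crossing; virtual crossings are not recorded. A long (framed) w-knot is an equivalence class of such diagrams under the moves (local; the rest of the diagram is unchanged): - R1$^s$: an isolated arrow (its two endpoints are adjacent on the line) may be reversed, keeping its sign. - R2: two arrows of opposite signs with adjacent tails and adjacent heads (heads in either order) may be removed or added. - R3: given three disjoint intervals $i,j,k$ of the line, in any order along the line, and positive arrows $i\to j$, $i\to k$, $j\to k$ with exactly their six endpoints in these intervals, ordered along the line as: in $i$, $(ij)$ before $(ik)$; in $j$, $(ij)$ before $(jk)$; in $k$, $(ik)$ before $(jk)$; one may reverse the order in all three intervals simultaneously. - OC (overcrossings commute): two adjacent arrow tails may be exchanged. The move R1 (removing an isolated arrow) and the exchange of adjacent heads are not imposed. **Singular w-knots.** An $m$-singular long w-knot is given by a Gauss diagram in which $m$ of the arrows are marked as semi-virtual. It stands for the formal $\mathbb{Q}$-linear combination of long w-knots obtained by replacing each positive semi-virtual arrow by (the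 positive arrow) $-$ (no arrow) and each negative semi-virtual arrow by (no arrow) $-$ (the negative arrow). Invariants are extended to such combinations linearly. The underlying arrow diagram $D$ keeps only the $m$ semi-virtual arrows and forgets their signs. **Arrow diagrams.** An arrow diagram is an oriented line with finitely many unsigned arrows with distinct endpoints on it, up to orientation-preserving diffeomorphism; its degree is the number of arrows. $\mathcal{A}^{sw}(\uparrow)$ is the degree completion of the $\mathbb{Q}$-vector space spanned by arrow diagrams modulo: - TC: exchanging two adjacent tails does not change the diagram. - $\overrightarrow{4T}$: for an arrow $\alpha$ and a second arrow $\beta$ with fixed tail, the sum of the two diagrams in which the head of $\beta$ is immediately before the tail of $\alpha$, respectively immediately before the head of $\alpha$, equals the sum of the two diagrams in which it is immediately after the tail of $\alpha$, respectively immediately after the head of $\alpha$. - RI: reversing an isolated arrow (one with adjacent endpoints) does not change the diagram. *)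

(* Defs.v *)
From HB Require Import structures.
From Stdlib Require Relation_Operators.
From mathcomp Require Import all_boot all_order ssralg ssrnum rat.
From mathcomp Require Import generic_quotient ring_quotient boolp.
From mathcomp.multinomials Require Import freeg.

Set Implicit Arguments.
Unset Strict Implicit.
Unset Printing Implicit Defensive.

Import GRing.Theory.
Local Open Scope ring_scope.
Local Open Scope quotient_scope.

(* A diagram is the word of arrow endpoints read along the oriented line.  An
   arrow is a pair (name, decoration).  Names only serve to match tails with
   heads: the relations below always include renaming, which accounts for
   diagrams being considered up to diffeomorphism of the line. *)
Section Diagrams.
Variable X : choiceType.

Definition arrow : Type := (nat * X)%type.
Definition letter : Type := (arrow * bool)%type.

Definition tl (a : arrow) : letter := (a, false).
Definition hd (a : arrow) : letter := (a, true).

Definition tails (w : seq letter) : seq arrow := [seq l.1 | l <- w & ~~ l.2].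
Definition heads (w : seq letter) : seq arrow := [seq l.1 | l <- w & l.2].

Definition wf (w : seq letter) : bool :=
  uniq [seq a.1 | a <- tails w] && perm_eq (tails w) (heads w).

Definition diag : Type := {w : seq letter | wf w}.

Definition word (D : diag) : seq letter := sval D.

Definition rename (f : nat -> nat) (w : seq letter) : seq letter :=
  [seq ((f l.1.1, l.1.2), l.2) | l <- w].

(* The part of a diagram unaffected by a local relation, with numbered holes
   standing for the intervals of the line where the relation takes place; the
   holes may come in any order along the line. *)
Definition context : Type := seq (letter + nat).

Definition has_holes (k : nat) (c : context) : bool :=
  perm_eq (pmap (fun s => if s is inr i then Some i else None) c) (iota 0 k).

Definition plug (c : context) (ws : seq (seq letter)) : seq letter :=
  flatten [seq match s with inl l => [:: l] | inr i => nth [::] ws i end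
          | s <- c].

End Diagrams.

Definition restrict (X Y : choiceType) (p : pred (arrow X)) (g : X -> Y)
    (w : seq (letter X)) : seq (letter Y) :=
  [seq ((l.1.1, g l.1.2), l.2) | l <- w & p l.1].

Section Restrict.
Variables (X Y : choiceType) (p : pred (arrow X)) (g : X -> Y).

Lemma tails_restrict w :
  tails (restrict p g w) = [seq (a.1, g a.2) | a <- tails w & p a].
Proof.
elim: w => //= -[[i x] []] w IH; rewrite /restrict /tails /=;
  by case: (p (i, x)) => /=; rewrite -/(tails _) ?IH.
Qed.

Lemma heads_restrict w :
  heads (restrict p g w) = [seq (a.1, g a.2) | a <- heads w & p a].
Proof.
elim: w => //= -[[i x] []] w IH; rewrite /restrict /heads /=;
  by case: (p (i, x)) => /=; rewrite -/(heads _) ?IH.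
Qed.

Lemma wf_restrict w : wf w -> wf (restrict p g w).
Proof.
case/andP=> u e; rewrite /wf tails_restrict heads_restrict; apply/andP; split.
  rewrite -map_comp; apply: subseq_uniq u.
  exact/map_subseq/filter_subseq.
by apply: perm_map; apply: perm_filter.
Qed.

End Restrict.

(* Long w-knots.  The decoration of an arrow is its sign, true meaning +. *)

Definition gauss : Type := diag bool.

Inductive wmove (D E : gauss) : Prop :=
| WRename f of injective f & word E = rename f (word D)
| WR1s c a of has_holes 1 c
    & word D = plug c [:: [:: tl a; hd a]]
    & word E = plug c [:: [:: hd a; tl a]]
| WR2 c a b of has_holes 2 c & a.2 = ~~ b.2
    & word D = plug c [:: [:: tl a; tl b]; [:: hd a; hd b]]
    & word E = plug c [:: [::]; [::]]
| WR2' c a b of has_holes 2 c & a.2 = ~~ b.2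
    & word D = plug c [:: [:: tl a; tl b]; [:: hd b; hd a]]
    & word E = plug c [:: [::]; [::]]
| WR3 c ij ik jk of has_holes 3 c & ij.2 = true & ik.2 = true & jk.2 = true
    & word D = plug c [:: [:: tl ij; tl ik]; [:: hd ij; tl jk];
                          [:: hd ik; hd jk]]
    & word E = plug c [:: [:: tl ik; tl ij]; [:: tl jk; hd ij];
                          [:: hd jk; hd ik]]
| WOC c a b of has_holes 1 c
    & word D = plug c [:: [:: tl a; tl b]]
    & word E = plug c [:: [:: tl b; tl a]].

Definition wequiv (D E : gauss) : bool :=
  `[< Relation_Operators.clos_refl_sym_trans gauss wmove D E >].

Lemma wequiv_equiv : equiv_class_of wequiv.
Proof.
split=> [D|D E|E D F].
- exact/asboolP/Relation_Operators.rst_refl.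
- by apply/asboolP/asboolP; apply: Relation_Operators.rst_sym.
- by move=> /asboolP h /asboolP k; apply/asboolP;
     apply: Relation_Operators.rst_trans h k.
Qed.

Canonical wequiv_rel := EquivRelPack wequiv_equiv.

Definition wknot : Type := {eq_quot wequiv_rel}.

Definition knot (D : gauss) : wknot := \pi_wknot D.

(* Singular w-knots.  The decoration of an arrow is (sign, semi-virtual?). *)

Definition semiv (a : arrow (bool * bool)%type) : bool := a.2.2.

Definition semivs (K : diag (bool * bool)%type) : seq (arrow (bool * bool)%type) :=
  [seq a <- tails (word K) | semiv a].

Definition singular (m : nat) : Type :=
  {K : diag (bool * bool)%type | size (semivs K) == m}.

(* Only the semi-virtual arrows listed in s are kept, as genuine crossings. *)
Definition resolve (K : diag (bool * bool)%type)
    (s : seq (arrow (bool * bool)%type)) : gauss :=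
  exist _ (restrict (fun a => ~~ semiv a || (a \in s)) fst (word K))
          (wf_restrict _ _ (valP K)).

(* A positive semi-virtual arrow contributes +1 if kept and -1 if removed, a
   negative one -1 if kept and +1 if removed; the bit b_i tells whether the
   i-th semi-virtual arrow is kept. *)
Definition resolution (m : nat) (K : singular m) : {freeg wknot / rat} :=
  \sum_(b : m.-tuple bool)
    << \prod_(p <- zip (semivs (val K)) b) (if p.1.2.1 == p.2 then 1 else -1)
       *g knot (resolve (val K) (mask b (semivs (val K)))) >>.

(* Quotient of a vector space by the subspace spanned by a set of vectors. *)
Section QuotientSpace.
Variables (R : nzRingType) (V : lmodType R) (G : V -> Prop).

Inductive spanned : V -> Prop :=
| Spanned0 : spanned 0
| SpannedD a g v of G g & spanned v : spanned (a *: g + v).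

Definition relspan : {pred V} := fun v => `[< spanned v >].

Lemma spannedD u v : spanned u -> spanned v -> spanned (u + v).
Proof.
move=> su sv; elim: su => [|a g w Gg _ IH]; first by rewrite add0r.
by rewrite -addrA; apply: SpannedD.
Qed.

Lemma spannedZ a u : spanned u -> spanned (a *: u).
Proof.
elim=> [|b g w Gg _ IH]; first by rewrite scaler0; apply: Spanned0.
by rewrite scalerDr scalerA; apply: SpannedD.
Qed.

Lemma relspan_zmod : zmod_closed relspan.
Proof.
split=> [|u v]; first exact/asboolP/Spanned0.
move=> /asboolP su /asboolP sv; apply/asboolP; apply: spannedD => //.
by rewrite -scaleN1r; apply: spannedZ.
Qed.

HB.instance Definition _ := GRing.isZmodClosed.Build V relspan relspan_zmod.

Definition quotient : Type := Quotient.quot relspan.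
HB.instance Definition _ := GRing.Zmodule.on quotient.

Definition cls (v : V) : quotient := \pi_quotient v.

Definition qscale (a : R) (x : quotient) : quotient := cls (a *: repr x).

Lemma cls_eq u v : (cls u == cls v) = (u - v \in relspan).
Proof. by rewrite /cls -Quotient.equivE eqmodE. Qed.

Lemma clsD u v : cls (u + v) = cls u + cls v.
Proof. by rewrite /cls raddfD. Qed.

Lemma clsZ a v : cls (a *: v) = qscale a (cls v).
Proof.
apply/eqP; rewrite /qscale cls_eq -scalerBr.
apply/asboolP/spannedZ/asboolP.
by change (v - repr (cls v) \in relspan); rewrite -cls_eq /cls reprK.
Qed.

Lemma clsK (x : quotient) : cls (repr x) = x.
Proof. by rewrite /cls reprK. Qed.

Fact qscaleA a b x : qscale a (qscale b x) = qscale (a * b) x.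
Proof. by rewrite -[x]clsK -!clsZ scalerA. Qed.
Fact qscale1 : left_id 1 qscale.
Proof. by move=> x; rewrite -[x]clsK -clsZ scale1r. Qed.
Fact qscaleDr : right_distributive qscale +%R.
Proof.
by move=> a x y; rewrite -[x]clsK -[y]clsK -clsD -!clsZ -clsD scalerDr.
Qed.
Fact qscaleDl x : {morph qscale^~ x : a b / a + b}.
Proof. by move=> a b; rewrite -[x]clsK -!clsZ -clsD scalerDl. Qed.

HB.instance Definition _ := GRing.Zmodule_isLmodule.Build R quotient
  qscaleA qscale1 qscaleDr qscaleDl.

End QuotientSpace.

Definition adiag (n : nat) : Type :=
  {D : diag unit | size (tails (word D)) == n}.

Definition aword (n : nat) (D : adiag n) : seq (letter unit) := word (val D).

Inductive sw_relator (n : nat) : {freeg (adiag n) / rat} -> Prop :=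
| SWRename (D E : adiag n) f of injective f & aword E = rename f (aword D)
  : sw_relator (<< D >> - << E >>)
| SWTC (D E : adiag n) c a b of has_holes 1 c
    & aword D = plug c [:: [:: tl a; tl b]]
    & aword E = plug c [:: [:: tl b; tl a]]
  : sw_relator (<< D >> - << E >>)
| SW4T (D1 D2 D3 D4 : adiag n) c a b of has_holes 2 c
    & aword D1 = plug c [:: [:: hd b; tl a]; [:: hd a]]
    & aword D2 = plug c [:: [:: tl a]; [:: hd b; hd a]]
    & aword D3 = plug c [:: [:: tl a; hd b]; [:: hd a]]
    & aword D4 = plug c [:: [:: tl a]; [:: hd a; hd b]]
  : sw_relator (<< D1 >> + << D2 >> - (<< D3 >> + << D4 >>))
| SWRI (D E : adiag n) c a of has_holes 1 c
    & aword D = plug c [:: [:: tl a; hd a]]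
    & aword E = plug c [:: [:: hd a; tl a]]
  : sw_relator (<< D >> - << E >>).

Definition Asw_deg (n : nat) : lmodType rat := quotient (@sw_relator n).

(* The relations are homogeneous, so the degree completion is the product of
   the homogeneous components. *)
Definition Asw : Type := forall n : nat, Asw_deg n.

Definition aclass (n : nat) (D : adiag n) : Asw_deg n :=
  cls (@sw_relator n) << D >>.

Definition extend (Z : wknot -> Asw) (K : {freeg wknot / rat}) : Asw :=
  fun n => fglift (fun k => Z k n) K.

Fact underlying_deg (m : nat) (K : singular m) :
  size (tails (restrict semiv (fun=> tt) (word (val K)))) == m.
Proof. by rewrite tails_restrict size_map; apply: (valP K). Qed.

Definition underlying (m : nat) (K : singular m) : adiag m :=
  exist _ (exist _ (restrict semiv (fun=> tt) (word (val K)))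
                   (wf_restrict _ _ (valP (val K))))
          (underlying_deg K).

(* Main.v *)
(* Z replaces each arrow of sign e by exp(e a), where a^m stands for m parallel
   copies of the arrow.  R2 is exp(a) exp(-a) = 1 and OC is TC.  R1s holds
   because an isolated arrow commutes with every arrow end.  For R3, TC makes
   a_ij and a_ik commute and 4T says that a_ij + a_ik commutes with a_jk, so
   exp(a_ij + a_ik) commutes with exp(a_jk).  Since exp(a) - 1 and 1 - exp(-a)
   both start with a, an m-singular knot has leading term its underlying arrow
   diagram.

   To avoid choosing fresh names for the copies, the degree n part is written
   as 1/n! times a sum over all maps phi from {0, ..., n-1} to the arrows of the
   knot: the arrow x is replaced by parallel arrows named by phi^-1(x), and the
   factors 1/m_x! of the exponentials come from the multinomial coefficients
   counting the phi with given fibre sizes m_x. *)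

Require Import Defs.
From mathcomp Require Import all_boot ssralg ssrnum rat.
From mathcomp Require Import generic_quotient boolp.
From mathcomp.multinomials Require Import freeg.

Set Implicit Arguments.
Unset Strict Implicit.
Unset Printing Implicit Defensive.

Import GRing.Theory.
Local Open Scope ring_scope.
Local Open Scope quotient_scope.

(** * Rearranging lists by adjacent transpositions *)

(** By induction under [cons a], the tail of [s] is first put in the order of [t] without [a]; then
    [a] is moved to its place by successive swaps. Every list met on the way is a permutation of
    [s], so swaps are only required for those. *)
Lemma eq_adjacent_swaps (T : eqType) (V : Type) (f : seq T -> V) (s t : seq T) :
    (forall x a b y, perm_eq (x ++ a :: b :: y) s ->
       f (x ++ a :: b :: y) = f (x ++ b :: a :: y)) ->
  perm_eq s t -> f s = f t.
Proof.
elim: s f t => [|a s IH] f t Hf; first by rewrite perm_sym => /perm_nilP ->.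
move=> st; have /splitPr t12 : a \in t by rewrite -(perm_mem st) mem_head.
case: t12 st => t1 t2 st.
have st' : perm_eq s (t1 ++ t2).
  by rewrite -(perm_cons a) (permPl st) perm_sym -cat_cons -cat_rcons perm_cat2r
     perm_sym perm_rcons.
have -> : f (a :: s) = f (a :: t1 ++ t2).
  apply: (IH (f \o cons a)) => // x b c y bc.
  by apply: (Hf (a :: x)); rewrite /= perm_cons.
have {}Hf x b c y : perm_eq (x ++ b :: c :: y) (a :: t1 ++ t2) ->
    f (x ++ b :: c :: y) = f (x ++ c :: b :: y).
  by move=> bc; apply: Hf; rewrite (permPl bc) perm_cons perm_sym.
elim: t1 f Hf {IH st st'} => //= b t1 IHt f Hf.
rewrite (Hf [::]) //=; apply: (IHt (f \o cons b)) => x c d y cd /=.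
apply: (Hf (b :: x)); apply: perm_trans (permEl (perm_catCA [:: b] [:: a] _)).
by rewrite /= perm_cons.
Qed.

(** * Filling contexts *)

Section Contexts.
Variable X : choiceType.
Implicit Types (c d : context X) (u v w : seq (letter X)).

Definition holes c : seq nat :=
  pmap (fun s => if s is inr i then Some i else None) c.

Lemma holes_cat c d : holes (c ++ d) = holes c ++ holes d.
Proof. exact: pmap_cat. Qed.

Lemma holes_inl u : holes (map inl u) = [::].
Proof. by elim: u. Qed.

Lemma plug_cat c d ws : plug (c ++ d) ws = plug c ws ++ plug d ws.
Proof. by rewrite /plug map_cat flatten_cat. Qed.

Lemma plug_inl u ws : plug (map inl u) ws = u.
Proof. by elim: u => //= a u {2}<-. Qed.

Lemma holes_inr i c : holes (inr i :: c) = i :: holes c.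
Proof. by []. Qed.

Lemma plug_inr i c ws : plug (inr i :: c) ws = nth [::] ws i ++ plug c ws.
Proof. by []. Qed.

Definition around u i v : context X := map inl u ++ inr i :: map inl v.

Lemma holes_around u i v : holes (around u i v) = [:: i].
Proof. by rewrite holes_cat holes_inr !holes_inl. Qed.

Lemma plug_around u i v ws : plug (around u i v) ws = u ++ nth [::] ws i ++ v.
Proof. by rewrite plug_cat plug_inr !plug_inl. Qed.

Definition inls c : seq (letter X) :=
  pmap (fun s => if s is inl l then Some l else None) c.

Lemma plug_perm c ws :
  perm_eq (plug c ws) (inls c ++ flatten [seq nth [::] ws i | i <- holes c]).
Proof.
elim: c => //= -[l|i] c IH; rewrite /plug /= -/(plug _ _); first by rewrite perm_cons.
by rewrite perm_sym perm_catCA perm_cat2l perm_sym.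
Qed.

Lemma has_holes_plug k c ws : has_holes k c -> size ws = k ->
  perm_eq (plug c ws) (inls c ++ flatten ws).
Proof.
move=> hc sz; rewrite (permPl (plug_perm c ws)) perm_cat2l.
rewrite -{2}(mkseq_nth [::] ws) sz; apply: perm_flatten; exact: perm_map.
Qed.

Lemma perm_plug k c ws ws' : has_holes k c -> size ws = k -> size ws' = k ->
  perm_eq (flatten ws) (flatten ws') -> perm_eq (plug c ws) (plug c ws').
Proof.
move=> hc s1 s2 h; rewrite (permPl (has_holes_plug hc s1)).
by rewrite perm_sym (permPl (has_holes_plug hc s2)) perm_cat2l perm_sym.
Qed.

(** This substitution of contexts for holes allows a relation to be applied at chosen places inside
    larger windows, the letters around them becoming part of the new context. *)
Lemma refill k k' c cs : has_holes k c -> size cs = k ->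
    perm_eq (flatten (map holes cs)) (iota 0 k') ->
  exists2 c', has_holes k' c' &
    forall ws, plug c' ws = plug c [seq plug d ws | d <- cs].
Proof.
move=> hc sz hcs.
exists (flatten [seq match s with inl l => [:: inl l] | inr i => nth [::] cs i end
                | s <- c]).
  rewrite /has_holes -/(holes _).
  have -> : holes (flatten [seq match s with inl l => [:: inl l]
      | inr i => nth [::] cs i end | s <- c])
    = flatten [seq holes (nth [::] cs i) | i <- holes c].
    by elim: c {hc} => //= -[l|i] c IH; rewrite holes_cat IH.
  apply: perm_trans hcs; rewrite -{2}(mkseq_nth [::] cs) sz -map_comp.
  by apply: perm_flatten; apply: perm_map.
move=> ws; elim: c {hc} => //= -[l|i] c IH; rewrite plug_cat IH //=.
rewrite [RHS]/plug /= -/(plug _ _); congr (_ ++ _).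
have [lt|ge] := ltnP i (size cs); first by rewrite (nth_map [::]).
by rewrite !nth_default ?size_map.
Qed.

Lemma holes_nil_plug c ws : holes c = [::] -> plug c ws = inls c.
Proof. by elim: c => //= -[l|i] c IH //= /IH; rewrite /plug /= => ->. Qed.

Lemma mem_holes i c : i \in holes c -> exists c1 c2, c = c1 ++ inr i :: c2.
Proof.
elim: c => //= -[l|j] c IH /=.
  by move=> /IH[c1 [c2 ->]]; exists (inl l :: c1), c2.
rewrite in_cons; case: eqVneq => [-> _|_ /IH[c1 [c2 ->]]]; first by exists [::], c.
by exists (inr j :: c1), c2.
Qed.

Lemma has_holes1 c : has_holes 1 c ->
  exists u v, forall x, plug c [:: x] = u ++ x ++ v.
Proof.
move=> hc; have /mem_holes[c1 [c2 e]] : 0%N \in holes c by rewrite (perm_mem hc).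
move: hc; rewrite e /has_holes -/(holes _) holes_cat /=.
rewrite -cat1s perm_catCA /= perm_cons => /perm_nilP h.
have [h1 h2] : holes c1 = [::] /\ holes c2 = [::] by case: (holes c1) h.
exists (inls c1), (inls c2) => x.
by rewrite plug_cat /plug /= -!/(plug _ _) !holes_nil_plug.
Qed.
End Contexts.

Arguments holes : simpl never.
Arguments around : simpl never.

(** * Well-formed words and the names in them *)

Section Words.
Variable X : choiceType.
Implicit Types u v w : seq (letter X).

Lemma tails_perm w w' : perm_eq w w' -> perm_eq (tails w) (tails w').
Proof. by move=> h; apply/perm_map/perm_filter. Qed.

Lemma heads_perm w w' : perm_eq w w' -> perm_eq (heads w) (heads w').
Proof. by move=> h; apply/perm_map/perm_filter. Qed.

Lemma wf_perm w w' : perm_eq w w' -> wf w = wf w'.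
Proof.
move=> h; rewrite /wf (perm_uniq (perm_map fst (tails_perm h))).
by rewrite (permPl (tails_perm h)) (permPr (heads_perm h)).
Qed.

Definition names w : seq nat := [seq l.1.1 | l <- w].

Lemma wf_uniq w : wf w -> uniq [seq (l.1.1, l.2) | l <- w].
Proof.
case/andP=> u e; have u' : uniq [seq a.1 | a <- heads w].
  by rewrite -(perm_uniq (perm_map fst e)).
have /perm_uniq <- := perm_map (fun l : letter X => (l.1.1, l.2))
  (permEl (perm_filterC (fun l : letter X => l.2) w)).
have eh : [seq (l.1.1, l.2) | l <- w & l.2] = [seq (i, true) | i <- map fst (heads w)].
  by rewrite -!map_comp; apply/eq_in_map => l; rewrite mem_filter => /andP[-> _].
have et : [seq (l.1.1, l.2) | l <- w & predC (fun l : letter X => l.2) l]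
     = [seq (i, false) | i <- map fst (tails w)].
  rewrite -!map_comp; apply/eq_in_map => l; rewrite mem_filter => /andP[/=].
  by case: l.2.
rewrite map_cat eh et cat_uniq !(map_inj_uniq (f := pair^~ _)) => [|i j []//|i j []//].
rewrite u u' andbT /=.
by apply/hasPn => _ /mapP[i _ ->]; apply/mapP => -[].
Qed.

Lemma mem_tails w a : (a \in tails w) = (tl a \in w).
Proof.
apply/mapP/idP => [[[b s]]|h]; first by rewrite mem_filter => /andP[/= + + ->]; case: s.
by exists (tl a) => //; rewrite mem_filter.
Qed.

Lemma mem_heads w a : (a \in heads w) = (hd a \in w).
Proof.
apply/mapP/idP => [[[b s]]|h]; first by rewrite mem_filter => /andP[/= + + ->]; case: s.
by exists (hd a) => //; rewrite mem_filter.
Qed.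

(** If both ends of an arrow lie in the holes, a letter outside with the same name would repeat one
    of them, against [wf_uniq]. Hence names in the windows can be exchanged without touching the
    context. *)
Lemma wf_plug k c (ws : seq (seq (letter X))) :
    has_holes k c -> size ws = k -> wf (plug c ws) ->
  uniq [seq (l.1.1, l.2) | l <- flatten ws] /\
  forall a, tl a \in flatten ws -> hd a \in flatten ws ->
    {in inls c, forall l, l.1.1 != a.1}.
Proof.
move=> hc sz /wf_uniq; rewrite (perm_uniq (perm_map _ (has_holes_plug hc sz))).
rewrite map_cat cat_uniq => /and3P[_ /hasPn h ->]; split=> // a ta ha l lc.
apply/eqP => e; have := map_f (fun l => (l.1.1, l.2)) lc; rewrite /= e.
by case: l.2; apply/negP; [apply: h (map_f _ ha)|apply: h (map_f _ ta)].
Qed.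

End Words.

(** * Classes of words in the space of arrow diagrams *)

Section Classes.
Variable n : nat.
Implicit Types (c : context unit) (u v w : seq (letter unit)) (a b : arrow unit).

Definition awf w := wf w && (size (tails w) == n).

Lemma awf_perm w w' : perm_eq w w' -> awf w = awf w'.
Proof. by move=> h; rewrite /awf (wf_perm h) (perm_size (tails_perm h)). Qed.

(* Words that are not diagrams of degree [n] get the junk value [0]; all the
   relations below stay true for them. *)
Definition cl w : Asw_deg n :=
  if (insub w : option {w | wf w}) is Some D then
    if (insub D : option {D : diag unit | size (tails (word D)) == n}) is Some E
    then aclass E else 0
  else 0.

Lemma cl_aword (D : adiag n) : cl (aword D) = aclass D.
Proof.
by rewrite /cl /aword /word -[sval (val D)]/(val (val D)) !valK.
Qed.

Lemma awfP w : reflect (exists D : adiag n, aword D = w) (awf w).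
Proof.
apply: (iffP andP) => [[w1 w2]|[D <-]]; last by split; [apply: (valP (val D))|apply: (valP D)].
by exists (exist _ (exist _ w w1) w2).
Qed.

Lemma cl_out w : ~~ awf w -> cl w = 0.
Proof.
move=> h; rewrite /cl; case: insubP => // D w1 eD; case: insubP => // E w2 eE.
by case/awfP: h; exists E; rewrite /aword eE /word -[sval D]/(val D) eD.
Qed.

Lemma cl_congr w w' : awf w = awf w' ->
    (forall D E : adiag n, aword D = w -> aword E = w' ->
       sw_relator (<< D >> - << E >>)) ->
  cl w = cl w'.
Proof.
move=> e h; case: (boolP (awf w)) (e) => [/awfP[D eD] /esym/awfP[E eE]|w0 /esym/negbT w0'].
  rewrite -eD -eE !cl_aword; apply/eqP; rewrite cls_eq; apply/asboolP.
  by rewrite -[_ - _]addr0 -[_ - _]scale1r; apply: SpannedD (h _ _ eD eE) (Spanned0 _).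
by rewrite !cl_out.
Qed.

Lemma cl_TC u a b v : cl (u ++ [:: tl a, tl b & v]) = cl (u ++ [:: tl b, tl a & v]).
Proof.
apply: cl_congr => [|D E eD eE].
  by apply: awf_perm; rewrite perm_cat2l -(perm_catCA [:: _] [:: _]).
have hc : has_holes 1 (around u 0 v) by rewrite /has_holes -/(holes _) holes_around.
by apply: (SWTC hc (a := a) (b := b)); rewrite plug_around.
Qed.

Lemma cl_RI u a v : cl (u ++ [:: tl a, hd a & v]) = cl (u ++ [:: hd a, tl a & v]).
Proof.
apply: cl_congr => [|D E eD eE].
  by apply: awf_perm; rewrite perm_cat2l -(perm_catCA [:: _] [:: _]).
have hc : has_holes 1 (around u 0 v) by rewrite /has_holes -/(holes _) holes_around.
by apply: (SWRI hc (a := a)); rewrite plug_around.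
Qed.

Lemma wf_rename (f : nat -> nat) w : injective f -> wf (rename f w) = wf w.
Proof.
move=> fi; pose g (a : arrow unit) : arrow unit := (f a.1, a.2).
have gi : injective g by move=> [i x] [j y] [/fi -> ->].
have et : tails (rename f w) = map g (tails w).
  by rewrite /tails /rename filter_map -!map_comp.
have eh : heads (rename f w) = map g (heads w).
  by rewrite /heads /rename filter_map -!map_comp.
have pe s t : perm_eq (map g s) (map g t) = perm_eq s t.
  by apply/idP/idP; [apply: perm_map_inj|apply: perm_map].
rewrite /wf et eh pe; congr (_ && _).
rewrite -[RHS](map_inj_uniq fi); congr uniq.
by elim: (tails w) => //= a s ->.
Qed.

Lemma cl_rename (f : nat -> nat) w : {in names w &, injective f} ->
  cl (rename f w) = cl w.
Proof.
move=> fi; pose s := names w; pose B := (\max_(i <- map f s) i).+1.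
have ltB i : i \in s -> (f i < B)%N.
  by move=> si; rewrite ltnS (big_rem (f i)) ?leq_maxl ?map_f.
(* The relator asks for a globally injective renaming. Names not in [w] are shifted by [B], above
   all values of [f] on [w], so [g] is injective and agrees with [f] on [w]. *)
pose g i := if i \in s then f i else (i + B)%N.
have gi : injective g.
  move=> i j; rewrite /g; case: ifP => si; case: ifP => sj.
  - exact: fi.
  - by move=> e; have := ltB _ si; rewrite e ltnNge leq_addl.
  - by move=> e; have := ltB _ sj; rewrite -e ltnNge leq_addl.
  - by move/addIn.
have -> : rename f w = rename g w.
  by apply/eq_in_map => l lw; rewrite /g /s (map_f (fun l => l.1.1) lw).
apply/esym/cl_congr => [|D E eD eE]; last by apply: (SWRename gi); rewrite eE eD.
rewrite /awf wf_rename // /tails !size_map !size_filter /rename count_map.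
by congr (_ && (_ == n)); apply: eq_count.
Qed.

(** The four words have the same letters, so either all of them are diagrams of degree [n] and the
    relator applies, or all classes are [0]. *)
Lemma cl_4T c a b : has_holes 2 c ->
  cl (plug c [:: [:: hd b; tl a]; [:: hd a]])
    + cl (plug c [:: [:: tl a]; [:: hd b; hd a]])
  = cl (plug c [:: [:: tl a; hd b]; [:: hd a]])
    + cl (plug c [:: [:: tl a]; [:: hd a; hd b]]).
Proof.
move=> hc; set w1 := plug _ _; set w2 := plug _ _; set w3 := plug _ _; set w4 := plug _ _.
have p x y x' y' : perm_eq (x ++ y) (x' ++ y') ->
    awf (plug c [:: x; y]) = awf (plug c [:: x'; y']).
  by move=> h; apply/awf_perm/(perm_plug hc) => //=; rewrite !cats0.
have e2 : awf w1 = awf w2 by apply/p/permEl/(perm_catCA [:: _] [:: _]).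
have e3 : awf w1 = awf w3 by apply/p/permEl/(perm_catCA [:: _] [:: _]).
have e4 : awf w1 = awf w4 by apply/p/permEl/(perm_catC [:: _] [:: _; _]).
case: (boolP (awf w1)) e2 e3 e4; last first.
  by move=> /cl_out -> /esym/negbT/cl_out -> /esym/negbT/cl_out -> /esym/negbT/cl_out ->.
move=> /awfP[D1 E1] /esym/awfP[D2 E2] /esym/awfP[D3 E3] /esym/awfP[D4 E4].
rewrite -E1 -E2 -E3 -E4 !cl_aword /aclass -!clsD; apply/eqP; rewrite cls_eq; apply/asboolP.
rewrite -[_ - _]addr0 -[_ - _]scale1r; apply: SpannedD (Spanned0 _).
exact: SW4T hc E1 E2 E3 E4.
Qed.

End Classes.

(** * Consequences of TC, 4T and RI *)

Section Relations.
Variable n : nat.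
Implicit Types (c : context unit) (u v w : seq (letter unit)) (a b : arrow unit)
  (s t : seq (arrow unit)).
Local Notation cl := (@cl n).
Local Notation awf := (@awf n).

Lemma cl_tails u s t v : perm_eq s t ->
  cl (u ++ map (@tl unit) s ++ v) = cl (u ++ map (@tl unit) t ++ v).
Proof.
apply: (eq_adjacent_swaps (f := fun s => cl (u ++ map (@tl unit) s ++ v))) => x a b y _.
by rewrite !map_cat /= -!catA !(catA u) cl_TC.
Qed.

(** Filling all holes but the first with [ws] leaves a one-hole context, where [cl_tails]
    applies. *)
Lemma cl_plug_tails k c s t ws : has_holes k c -> k = (size ws).+1 -> perm_eq s t ->
  cl (plug c (map (@tl unit) s :: ws)) = cl (plug c (map (@tl unit) t :: ws)).
Proof.
move=> hc hk st.
have [||c' /has_holes1[u [v e']] e] := refill (k' := 1) hc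
  (cs := around [::] 0 [::] :: map (map inl) ws).
- by rewrite hk /= size_map.
- rewrite map_cons holes_around /= (_ : [seq holes i | i <- _] = nseq (size ws) [::]).
    by elim: (size ws).
  by elim: ws {hk} => //= w ws IH; rewrite holes_inl IH.
have ew x : cl (plug c (x :: ws)) = cl (u ++ x ++ v).
  rewrite -e' e map_cons plug_around /= cats0 -map_comp.
  by congr (cl (plug _ (_ :: _))); elim: ws {hk e} => //= w ws IH; rewrite plug_inl -IH.
by rewrite !ew; apply: cl_tails.
Qed.

Lemma rename_plug (f : nat -> nat) c ws :
    {in inls c, forall l, f l.1.1 = l.1.1} ->
  rename f (plug c ws) = plug c (map (rename f) ws).
Proof.
elim: c => //= -[[[i []] s]|i] c IH fc; rewrite /plug /= -!/(plug _ _).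
  rewrite (fc ((i, tt), s)) ?mem_head //; congr (_ :: _); apply: IH => l lc.
  by apply: fc; rewrite in_cons lc orbT.
rewrite [LHS]map_cat -!/(rename _ _) IH //; congr (_ ++ _).
have [lt|ge] := ltnP i (size ws); first by rewrite (nth_map [::]).
by rewrite !nth_default ?size_map.
Qed.

(* Exchanging the names of [a] and [b] turns the swap of their heads into a
   swap of their tails. *)
Lemma cl_parallel_swap c a b : has_holes 2 c ->
  cl (plug c [:: [:: tl a; tl b]; [:: hd a; hd b]])
    = cl (plug c [:: [:: tl a; tl b]; [:: hd b; hd a]]).
Proof.
move=> hc; set w := plug _ _; set w' := plug _ _.
have aw : awf w = awf w'.
  by apply/awf_perm/(perm_plug hc) => //=; rewrite !perm_cons
    (permPl (permEl (perm_catCA [:: _] [:: _] [::]))).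
case: (boolP (awf w)) (aw) => [ww _|w0 /esym/negbT w0']; last by rewrite !cl_out.
have [|+ fresh] := wf_plug hc _ (andP ww).1 => //.
rewrite /= !inE !xpair_eqE /= !andbT !andbF /= => /andP[ab _].
have na : {in inls c, forall l, l.1.1 != a.1} by apply: fresh; rewrite !inE eqxx ?orbT.
have nb : {in inls c, forall l, l.1.1 != b.1} by apply: fresh; rewrite !inE eqxx ?orbT.
pose f k := if k == a.1 then b.1 else if k == b.1 then a.1 else k.
have fi : injective f.
  apply: inv_inj => k; rewrite /f; case: (eqVneq k a.1) => [->|ka].
    by rewrite eqxx; case: eqP.
  by case: (eqVneq k b.1) => [->|kb]; rewrite ?eqxx // (negPf ka) (negPf kb).
rewrite -(@cl_rename n f w); last by move=> ? ? _ _ /fi.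
rewrite rename_plug => [|l lc]; last by rewrite /f (negPf (na _ lc)) (negPf (nb _ lc)).
have [fa fb] : f a.1 = b.1 /\ f b.1 = a.1 by rewrite /f !eqxx; case: eqP.
rewrite /w' /= fa fb; case: a b {na nb ab fresh f fi fa fb w w' aw ww} => [i []] [j []].
apply: (@cl_plug_tails 2 c [:: (j, tt); (i, tt)] [:: (i, tt); (j, tt)] [:: _] hc erefl).
exact: (permEl (perm_catC [:: _] [:: _])).
Qed.

(** It suffices to swap two neighbouring heads. TC allows the tails of these two arrows to be
    brought next to each other at the front of the tail block, where [cl_parallel_swap] applies. *)
Lemma cl_plug_heads c s t : has_holes 2 c -> perm_eq s t ->
  cl (plug c [:: map (@tl unit) s; map (@hd unit) s])
    = cl (plug c [:: map (@tl unit) s; map (@hd unit) t]).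
Proof.
move=> hc; apply: (eq_adjacent_swaps (f := fun t =>
  cl (plug c [:: map (@tl unit) s; map (@hd unit) t]))) => x a b y e.
rewrite perm_sym in e; rewrite !(cl_plug_tails hc _ e) //.
have e' : perm_eq (x ++ [:: a, b & y]) ([:: a; b] ++ x ++ y).
  by rewrite -(permPr (permEl (perm_catCA _ _ _))).
rewrite !(cl_plug_tails hc _ e') // !map_cat /=.
have [//||c' hc' ec] := refill (k' := 2) hc
  (cs := [:: around [::] 0 (map (@tl unit) (x ++ y));
             around (map (@hd unit) x) 1 (map (@hd unit) y)]).
  by rewrite !map_cons !holes_around.
have := cl_parallel_swap a b hc'; rewrite !ec !map_cons !plug_around /=.
by rewrite !map_cat.
Qed.

(** In 4T for an isolated [a], immediately after the tail and immediately before the head are the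
    same place, so these two terms cancel. *)
Lemma cl_isolated_hd u a b v :
  cl (u ++ [:: tl a, hd a, hd b & v]) = cl (u ++ [:: hd b, tl a, hd a & v]).
Proof.
pose c : context unit := map inl u ++ [:: inr 0, inr 1 & map inl v].
have hc : has_holes 2 c by rewrite /has_holes -/(holes _) holes_cat !holes_inr !holes_inl.
have ec x y : plug c [:: x; y] = u ++ x ++ y ++ v.
  by rewrite plug_cat !plug_inr !plug_inl.
have := cl_4T n a b hc; rewrite !ec /= => /eqP.
by rewrite [X in _ == X]addrC (inj_eq (addIr _)) => /eqP ->.
Qed.

(* 4T moves [hd a] across [tl b] at the price of a commutator of [hd a] and
   [hd b], which vanishes because the tails of [a] and [b] are adjacent. *)
Lemma cl_isolated_tl u a b v :
  cl (u ++ [:: tl a, hd a, tl b & v]) = cl (u ++ [:: tl b, tl a, hd a & v]).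
Proof.
set w := u ++ _; set w' := u ++ _.
have aw : awf w = awf w'.
  by apply: awf_perm; rewrite perm_cat2l; apply/permEl/(perm_catCA [:: _; _] [:: _]).
case: (boolP (awf w)) (aw) => [ww _|w0 /esym/negbT w0']; last by rewrite !cl_out.
have key c : has_holes 2 c -> cl (plug c [:: [:: tl a; hd a; tl b]; [:: hd b]])
    = cl (plug c [:: [:: tl b; tl a; hd a]; [:: hd b]]).
  move=> hc; have [//||c1 hc1 e1] := refill (k' := 2) hc
    (cs := [:: around [:: tl a] 0 [::]; around [::] 1 [::]]).
    by rewrite !map_cons !holes_around.
  have [//||c2 hc2 e2] := refill (k' := 1) hc
    (cs := [:: around [::] 0 [:: hd a]; map inl [:: hd b]]).
    by rewrite !map_cons !holes_around.
  have := cl_4T n b a hc1; rewrite !e1 !map_cons !plug_around /=.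
  rewrite -(cl_parallel_swap _ _ hc) => /addIr ->.
  have [u' [v' e]] := has_holes1 hc2.
  have := cl_TC n u' a b v'; rewrite -!(e [:: _; _]) !e2 !map_cons !plug_around.
  by rewrite -[[:: inl _]]/(map inl [:: hd b]) plug_inl.
(* The head of [b] lies to the left or to the right of the moving arrow; the two cases give two-hole
   contexts with the holes in opposite orders, both covered by [key]. *)
have : hd b \in w.
  rewrite -mem_heads -(perm_mem (andP (andP ww).1).2) mem_tails.
  by rewrite mem_cat !in_cons eqxx !orbT.
rewrite mem_cat !in_cons; case/orP.
  move=> /path.splitPr; rewrite /w /w'; case=> u1 u2.
  pose c : context unit := around u1 1 u2 ++ inr 0 :: map inl v.
  have hc : has_holes 2 c.
    by rewrite /has_holes -/(holes _) holes_cat holes_around holes_inr holes_inl.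
  have := key _ hc; rewrite /c /around !plug_cat !plug_inr !plug_inl /=.
  by rewrite -!catA.
have ab : b != a.
  apply: contraTneq (wf_uniq (andP ww).1) => ba.
  by rewrite /w ba map_cat cat_uniq /= !in_cons eqxx !orbT !andbF.
rewrite /hd /tl !xpair_eqE (negPf ab) /= !andbF /=.
move=> /path.splitPr; rewrite /w /w'; case=> v1 v2.
pose c : context unit := map inl u ++ inr 0 :: around v1 1 v2.
have hc : has_holes 2 c.
  by rewrite /has_holes -/(holes _) holes_cat holes_inl holes_inr holes_around.
have pc x y : plug c [:: x; y] = u ++ x ++ v1 ++ y ++ v2.
  by rewrite plug_cat plug_inl plug_inr plug_around.
by have := key _ hc; rewrite !pc.
Qed.

Lemma cl_isolated u a x v :
  cl (u ++ [:: tl a, hd a & x ++ v]) = cl (u ++ x ++ [:: tl a, hd a & v]).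
Proof.
elim: x u => //= -[b s] x IH u.
have -> : cl (u ++ [:: tl a, hd a, (b, s) & x ++ v])
    = cl (u ++ [:: (b, s), tl a, hd a & x ++ v]).
  by case: s; [apply: cl_isolated_hd|apply: cl_isolated_tl].
by have := IH (rcons u (b, s)); rewrite !cat_rcons.
Qed.

(** Both sides equal the word [N s] of isolated arrows placed one after another. TC makes one arrow
    of the block isolated, and [cl_isolated] slides it out past the rest; on the right-hand side RI
    first turns it around. *)
Lemma cl_isolated_block u s v :
  cl (u ++ map (@tl unit) s ++ map (@hd unit) s ++ v)
    = cl (u ++ map (@hd unit) s ++ map (@tl unit) s ++ v).
Proof.
pose N s := flatten [seq [:: tl a; hd a] | a : arrow unit <- s].
transitivity (cl (u ++ N s ++ v)).
  elim: s u => //= a s IH u.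
  have := cl_tails u (map (@hd unit) (a :: s) ++ v) (permEl (perm_rcons a s)).
  rewrite /= => <-; rewrite -cats1 map_cat -!catA /= -cl_isolated.
  by have := IH (u ++ [:: tl a; hd a]); rewrite -!catA.
elim/last_ind: s v => //= s a IH v.
have := cl_tails (u ++ map (@hd unit) (rcons s a)) v (permEl (perm_rcons a s)).
rewrite -!catA => ->.
rewrite -cats1 map_cat /= /N map_cat flatten_cat -/(N s) /= -!catA /=.
have := cl_RI n (u ++ map (@hd unit) s) a (map (@tl unit) s ++ v).
have := cl_isolated (u ++ map (@hd unit) s) a (map (@tl unit) s) v.
by rewrite -!catA => -> <-; rewrite IH.
Qed.

End Relations.
(** * Sums over words *)

Section SeqWords.
Variable T : eqType.
Implicit Types (A : seq T) (s u v : seq T).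

(** A word [s] of length [n] encodes the map from positions [0, ..., n-1] to entries of [A]; sums
    over maps are sums over this list. *)
Fixpoint words n A : seq (seq T) :=
  if n is m.+1 then [seq x :: s | x <- A, s <- words m A] else [:: [::]].

Lemma wordsS n A : words n.+1 A = [seq x :: s | x <- A, s <- words n A].
Proof. by []. Qed.

Lemma mem_words n A s : (s \in words n A) = (size s == n) && all (mem A) s.
Proof.
elim: n s => [|n IH] [|x s] //=.
  by apply/negP => /allpairsP[? []].
rewrite eqSS andbCA -IH; apply/allpairsP/andP => [[[y t] /= [yA tw [-> ->]]]|[xA sw]] //.
by exists (x, s).
Qed.

Lemma words_uniq n A : uniq A -> uniq (words n A).
Proof.
by move=> uA; elim: n => //= n IH; apply: allpairs_uniq => // -[x s] [y t] _ _ [-> ->].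
Qed.

Lemma words_perm n A B : perm_eq A B -> perm_eq (words n A) (words n B).
Proof. by move=> AB; elim: n => //= n; apply: perm_allpairs. Qed.

Lemma words_filter n (p : pred T) A :
  words n (filter p A) = filter (all p) (words n A).
Proof.
elim: n => //= n ->; elim: A (words n A) => //= x A IH W.
rewrite filter_cat -IH filter_map; case px: (p x) => /=.
  by congr (_ ++ _); congr map; apply: eq_filter => s /=; rewrite px.
suff -> : filter (preim (cons x) (all p)) W = [::] by [].
apply: etrans (filter_pred0 W); apply: eq_filter => s /=.
by rewrite px.
Qed.

Variables (R : nzRingType) (V : lmodType R).

(** This is exp(a) exp(-a) = 1 in terms of maps: [G] does not distinguish [a] from [b] and their
    weights are opposite, so all words using either letter cancel, position by position. *)
Lemma big_words_cancel n (a b : T) A (f : T -> R) (G : seq T -> V) :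
    f a + f b = 0 -> (forall u v, G (u ++ a :: v) = G (u ++ b :: v)) ->
  \sum_(s <- words n [:: a, b & A]) (\prod_(x <- s) f x) *: G s
    = \sum_(s <- words n A) (\prod_(x <- s) f x) *: G s.
Proof.
move=> fab; elim: n G => [|n IH] G Gab; first by rewrite !big_seq1.
have step x (B : seq T) : \sum_(s <- words n B) (\prod_(y <- x :: s) f y) *: G (x :: s)
    = f x *: \sum_(s <- words n B) (\prod_(y <- s) f y) *: G (x :: s).
  by rewrite scaler_sumr; apply: eq_bigr => s _; rewrite big_cons scalerA.
rewrite !wordsS !big_allpairs_dep /= !big_cons addrA !step.
rewrite [X in f b *: X](eq_bigr (fun s => (\prod_(y <- s) f y) *: G (a :: s))); last first.
  by move=> s _; rewrite (Gab [::]).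
rewrite -scalerDl fab scale0r add0r; apply: eq_bigr => x _; rewrite !step IH // => u v.
exact: (Gab (x :: u)).
Qed.

Definition update (f : T -> T) p s :=
  take p s ++ (if drop p s is x :: t then f x :: t else [::]).

(** Since [f] permutes the entries of [A], applying it at position [p] alone permutes the words, and
    the sum may be reindexed. If [p] is past the end, [update] is the identity. *)
Lemma big_words_update n A (f : T -> T) p (P : pred (seq T)) (F : seq T -> V) :
    perm_eq (map f A) A ->
  \sum_(s <- words n A | P s) F s
    = \sum_(s <- words n A | P (update f p s)) F (update f p s).
Proof.
move=> fA; elim: n p P F => [|n IH] p P F.
  by rewrite /= !big_cons !big_nil /update take_oversize // drop_oversize.
rewrite /= big_mkcond [RHS]big_mkcond !big_allpairs_dep /=.
case: p => [|p].
  rewrite -(perm_big _ fA) big_map; apply: eq_bigr => x _; apply: eq_bigr => s _.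
  by rewrite /update take0 drop0.
apply: eq_bigr => x _; rewrite -!big_mkcond.
by rewrite (IH p (fun s => P (x :: s)) (fun s => F (x :: s))).
Qed.

End SeqWords.

Lemma words_map (T U : eqType) (f : T -> U) n A :
  words n (map f A) = map (map f) (words n A).
Proof.
elim: n => //= n IH; rewrite IH map_allpairs allpairs_mapl allpairs_mapr.
by [].
Qed.

(** * Exponentials of arrows *)

Section Expansion.
Variables (n : nat) (phi : nat -> nat).

(** Each copy is named by its position [p]. A general predicate [q], rather than one arrow name,
    allows the copies of two parallel arrows to be merged into one bundle ordered by position. *)
Definition copies (q : pred nat) : seq (arrow unit) :=
  [seq (p, tt) | p <- iota 0 n & q (phi p)].

Lemma copies_predU q q' : (forall i, ~~ (q i && q' i)) ->
  perm_eq (copies q ++ copies q') (copies (predU q q')).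
Proof.
move=> qq'; rewrite /copies -map_cat; apply: perm_map.
elim: (iota 0 n) => //= p s IH; case: (boolP (q _)) (qq' (phi p)) => /= [_|_ _].
  by move=> /negPf ->; rewrite perm_cons.
by case: ifP => // _; rewrite -cat1s perm_catCA perm_cons.
Qed.

Variable X : choiceType.
Implicit Types (l : letter X) (c : context X).

Definition cable l : seq (letter unit) := [seq (a, l.2) | a <- copies (pred1 l.1.1)].

Definition expand (w : seq (letter X)) : seq (letter unit) := flatten (map cable w).

Definition expandc c : context unit :=
  flatten [seq match s with inl l => map inl (cable l) | inr i => [:: inr i] end
          | s <- c].

Lemma has_holes_expandc k c : has_holes k c -> has_holes k (expandc c).
Proof.
rewrite /has_holes -!/(holes _) => hc; suff -> : holes (expandc c) = holes c by [].
by elim: c {hc} => //= -[l|i] c IH; rewrite holes_cat IH ?holes_inl.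
Qed.

Lemma expand_plug c ws : expand (plug c ws) = plug (expandc c) (map expand ws).
Proof.
elim: c => // -[l|i] c IH; first by rewrite [RHS]plug_cat plug_inl -IH.
rewrite -[expandc (inr i :: c)]/(inr i :: expandc c) !plug_inr -IH.
rewrite /expand map_cat flatten_cat; congr (_ ++ _).
have [lt|ge] := ltnP i (size ws); first by rewrite (nth_map [::]).
by rewrite !nth_default ?size_map.
Qed.

End Expansion.

Lemma eq_copies n phi psi (q q' : pred nat) :
  (forall p, (p < n)%N -> q (phi p) = q' (psi p)) -> copies n phi q = copies n psi q'.
Proof.
by move=> h; congr map; apply: eq_in_filter => p; rewrite mem_iota => /h.
Qed.

Lemma eq_expandc n phi psi (X : choiceType) (c : context X) :
    {in inls c, forall l p, (p < n)%N -> (phi p == l.1.1) = (psi p == l.1.1)} ->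
  expandc n phi c = expandc n psi c.
Proof.
elim: c => //= -[l|i] c IH h; last by rewrite /expandc /= -!/(expandc _ _ _) IH.
rewrite /expandc /= -!/(expandc _ _ _) IH; last first.
  by move=> l' lc; apply: h; rewrite in_cons lc orbT.
suff e : copies n phi (pred1 l.1.1) = copies n psi (pred1 l.1.1).
  by rewrite /cable e.
by apply: eq_copies => p; apply: h; rewrite mem_head.
Qed.

(** Unlike in [eq_adjacent_swaps], the only swaps used move an element satisfying [P] to the left
    across one that does not. In R3 only these are available: 4T moves a copy of [jk] across a copy
    of [ij] or [ik]. *)
Lemma block_swap (T : eqType) (V : Type) (P : pred T) (f : seq T -> V) (s t : seq T) :
    all (predC P) s -> all P t ->
    (forall u x y v, perm_eq (u ++ [:: x, y & v]) (s ++ t) -> ~~ P x -> P y ->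
       f (u ++ [:: x, y & v]) = f (u ++ [:: y, x & v])) ->
  f (s ++ t) = f (t ++ s).
Proof.
elim: s f => [|x s IH] f /= Ps Pt Hf; first by rewrite cats0.
case/andP: Ps => Px Ps.
have -> : f (x :: s ++ t) = f (x :: t ++ s).
  apply: (IH (f \o cons x)) => // u y z v yz; apply: (Hf (x :: u)).
  by rewrite perm_cons.
have {}Hf u y v : perm_eq (u ++ [:: x, y & v]) (x :: t ++ s) -> P y ->
    f (u ++ [:: x, y & v]) = f (u ++ [:: y, x & v]).
  by move=> xy Py; apply: Hf; rewrite // (permPl xy) perm_cons perm_catC.
elim: t f Pt Hf {IH} => //= y t IHt f /andP[Py Pt] Hf.
rewrite (Hf [::]) //; apply: (IHt (f \o cons y)) => // u z v xz Pz /=.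
apply: (Hf (y :: u)) => //; apply: perm_trans (permEl (perm_catCA [:: y] [:: x] _)).
by rewrite /= perm_cons.
Qed.

Definition weight (s : seq (arrow bool)) : rat := \prod_(a <- s) (if a.2 then 1 else -1).

(** The map encoded by [s], followed by taking names. Positions past the end get the default [0];
    expansions in degree [n] read only positions below [n]. *)
Definition named (X : choiceType) (s : seq (arrow X)) : nat -> nat := nth 0%N (unzip1 s).

(** This is [n!] times the degree [n] part of the product of the exponentials; the factorial is
    divided out in [Zexp]. *)
Definition zsum n (w : seq (letter bool)) : Asw_deg n :=
  \sum_(s <- words n (tails w)) weight s *: cl n (expand n (named s) w).

(** * Invariance under the moves *)

Section Moves.
Variable n : nat.

(** For the moves that already hold for each map [phi] separately, namely R1s and OC. In R2 and R3
    terms for different maps have to be combined. *)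
Lemma zsum_congr w w' : perm_eq w w' ->
    (forall phi, cl n (expand n phi w) = cl n (expand n phi w')) ->
  zsum n w = zsum n w'.
Proof.
move=> ww' e; rewrite /zsum (perm_big _ (words_perm n (tails_perm ww'))).
by apply: eq_bigr => s _; rewrite e.
Qed.

Lemma zsum_rename f w : injective f -> zsum n (rename f w) = zsum n w.
Proof.
move=> fi; pose g (a : arrow bool) : arrow bool := (f a.1, a.2).
have et : tails (rename f w) = map g (tails w).
  by rewrite /tails /rename filter_map -!map_comp.
rewrite /zsum et words_map big_map; apply: eq_big_seq => s.
rewrite mem_words => /andP[/eqP sz _]; rewrite /weight big_map; congr (_ *: cl n _).
rewrite /expand /rename -map_comp; congr flatten; apply: eq_map => l /=.
congr map; apply: eq_copies => p lt /=.
rewrite /named /unzip1 -map_comp !(nth_map (0%N, true)) ?sz //=.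
exact: inj_eq.
Qed.

Lemma zsum_R1s c a : has_holes 1 c ->
  zsum n (plug c [:: [:: tl a; hd a]]) = zsum n (plug c [:: [:: hd a; tl a]]).
Proof.
move=> hc; apply: zsum_congr => [|phi].
  by apply: (perm_plug hc) => //; apply/permEl/(perm_catC [:: _] [:: _]).
rewrite !expand_plug.
have [u [v e]] := has_holes1 (has_holes_expandc n phi hc).
rewrite !e /expand /= !cats0 -!catA.
exact: cl_isolated_block.
Qed.

Lemma zsum_OC c a b : has_holes 1 c ->
  zsum n (plug c [:: [:: tl a; tl b]]) = zsum n (plug c [:: [:: tl b; tl a]]).
Proof.
move=> hc; apply: zsum_congr => [|phi].
  by apply: (perm_plug hc) => //; apply/permEl/(perm_catC [:: _] [:: _]).
rewrite !expand_plug.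
have [u [v e]] := has_holes1 (has_holes_expandc n phi hc).
rewrite !e /expand /= !cats0 -!map_cat.
by apply: (cl_tails n u v); rewrite !map_cat perm_catC.
Qed.

Lemma zsum_R2 c a b h : has_holes 2 c -> a.2 = ~~ b.2 ->
    perm_eq h [:: a; b] -> wf (plug c [:: [:: tl a; tl b]; map (@hd bool) h]) ->
  zsum n (plug c [:: [:: tl a; tl b]; map (@hd bool) h])
    = zsum n (plug c [:: [::]; [::]]).
Proof.
move=> hc ab hh ww; set w := plug _ _; set w0 := plug _ _.
have [//|uw fresh] := wf_plug hc _ ww.
have ha : hd a \in map (@hd bool) h by rewrite map_f // (perm_mem hh) !inE eqxx.
have hb : hd b \in map (@hd bool) h by rewrite map_f // (perm_mem hh) !inE eqxx orbT.
have na : {in inls c, forall l, l.1.1 != a.1}.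
  by apply: fresh; rewrite /= cats0 !in_cons ?ha ?hb ?eqxx ?orbT.
have nb : {in inls c, forall l, l.1.1 != b.1}.
  by apply: fresh; rewrite /= cats0 !in_cons ?hb ?eqxx ?orbT.
have nab : a.1 != b.1.
  by move: uw; rewrite /= !inE xpair_eqE /= andbT negb_or => /andP[/andP[]].
have tw : perm_eq (tails w) [:: a, b & tails w0].
  have pw : perm_eq w ([:: tl a; tl b] ++ map (@hd bool) h ++ w0).
    rewrite (permPl (has_holes_plug hc _)) // perm_catC /= cats0.
    rewrite /= !perm_cons perm_cat2l perm_sym.
    by rewrite (permPl (has_holes_plug hc _)) // cats0.
  apply: perm_trans (tails_perm pw) _; rewrite /tails !filter_cat !map_cat.
  by rewrite (_ : filter _ (map _ h) = [::]) //; elim: (h).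
pose q : pred nat := predU (pred1 a.1) (pred1 b.1).
pose G (phi : nat -> nat) := cl n (plug (expandc n phi c)
  [:: map (@tl unit) (copies n phi q); map (@hd unit) (copies n phi q)]).
have wG phi : cl n (expand n phi w) = G phi.
  have hc' := has_holes_expandc n phi hc.
  have pq : perm_eq (copies n phi (pred1 a.1) ++ copies n phi (pred1 b.1))
      (copies n phi q).
    by apply: copies_predU => i; apply/negP => /= /andP[/eqP -> /eqP/eqP]; apply/negP.
  rewrite expand_plug !map_cons.
  pose hh' := flatten [seq copies n phi (pred1 x.1) | x <- h].
  rewrite (_ : expand n phi _ = map (@tl unit)
    (copies n phi (pred1 a.1) ++ copies n phi (pred1 b.1))); last first.
    by rewrite /expand /= cats0 map_cat.
  rewrite (_ : expand n phi (map _ h) = map (@hd unit) hh'); last first.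
    by rewrite /expand /hh' map_flatten -!map_comp.
  rewrite (cl_plug_tails n hc' _ pq) //; symmetry; apply: cl_plug_heads => //.
  rewrite perm_sym -(permPr pq); apply: perm_trans (perm_flatten (perm_map _ hh)) _.
  by rewrite /= cats0.
rewrite {1}/zsum (perm_big _ (words_perm n tw)).
under eq_bigr do rewrite wG.
rewrite (big_words_cancel _ _ (G := fun s => G (named s))); first last.
- move=> u v; rewrite /G.
  have agree (p : pred nat) i : p a.1 = p b.1 ->
      p (named (u ++ a :: v) i) = p (named (u ++ b :: v) i).
    by move=> pab; rewrite /named /unzip1 !map_cat /= !nth_cat; case: ifP => // _;
      case: (i - _)%N.
  have -> : copies n (named (u ++ a :: v)) q = copies n (named (u ++ b :: v)) q.
    by apply: eq_copies => i _; apply: agree; rewrite /q /= !eqxx orbT.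
  rewrite (@eq_expandc n _ (named (u ++ b :: v))) // => l lc i _.
  by apply: (agree (pred1 l.1.1)); rewrite /= eq_sym (negPf (na _ lc)) eq_sym (negPf (nb _ lc)).
- by rewrite ab; case: b.2; rewrite /= ?subrr ?addNr.
apply: eq_big_seq => s; rewrite mem_words => /andP[/eqP sz /allP sA].
have t0 : perm_eq (tails w0) (tails (inls c)).
  by apply/tails_perm; rewrite (permPl (has_holes_plug hc _)) // cats0.
(* The surviving maps take values in the other arrows, so the bundle is empty. *)
have q0 : copies n (named s) q = [::].
  rewrite /copies (_ : filter _ _ = [::]) //; apply/eqP; rewrite -[_ == _]negbK -has_filter.
  apply/hasPn => i; rewrite mem_iota => /= lt; rewrite /named (nth_map a) ?sz //.
  have : nth a s i \in tails w0 by apply: sA; rewrite mem_nth ?sz.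
  rewrite (perm_mem t0) mem_tails => lc.
  by rewrite /q /= negb_or (na _ lc) (nb _ lc).
by rewrite /G q0 expand_plug.
Qed.

End Moves.

(** * The third Reidemeister move *)

Lemma named_update (X : choiceType) (g : nat -> nat) p (s : seq (arrow X)) r :
  named (update (fun a => (g a.1, a.2)) p s) r
    = if (r == p) && (p < size s)%N then g (named s p) else named s r.
Proof.
elim: s p r => [|a s IH] p r; first by rewrite ltn0 andbF.
case: p => [|p]; first by rewrite /update take0 drop0; case: r.
by case: r => [|r] //=; rewrite -IH.
Qed.

Lemma weight_update (g : nat -> nat) p s :
  weight (update (fun a => (g a.1, a.2)) p s) = weight s.
Proof.
rewrite /weight /update -{3}(cat_take_drop p s) !big_cat /=; congr (_ * _).
by case: (drop p s) => // a t; rewrite !big_cons.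
Qed.

Section R3.
Variables (n x y z : nat) (neq_xy : x != y) (neq_xz : x != z) (neq_yz : y != z).
Implicit Types phi psi : nat -> nat.

(* The three intervals of R3 when the copies [p] of the arrows [x : i -> j],
   [y : i -> k] and [z : j -> k] are attached one after the other in the order
   of the list [s]; [phi p] tells which of the arrows [p] is a copy of. *)
Definition strand_i phi s : seq (letter unit) :=
  [seq tl (p, tt) | p <- s & (phi p == x) || (phi p == y)].
Definition strand_j phi s : seq (letter unit) :=
  [seq ((p, tt), phi p == x) | p <- s & (phi p == x) || (phi p == z)].
Definition strand_k phi s : seq (letter unit) :=
  [seq hd (p, tt) | p <- s & (phi p == y) || (phi p == z)].
Definition strands phi s : seq (seq (letter unit)) :=
  [:: strand_i phi s; strand_j phi s; strand_k phi s].

Lemma strands_cat phi s u t : strands phi (s ++ u ++ t) =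
  [:: strand_i phi s ++ strand_i phi u ++ strand_i phi t;
      strand_j phi s ++ strand_j phi u ++ strand_j phi t;
      strand_k phi s ++ strand_k phi u ++ strand_k phi t].
Proof.
by rewrite /strands /strand_i /strand_j /strand_k !filter_cat !map_cat.
Qed.

(** The tail of [p] sits at the same place of interval [i] in all four terms, while its head is next
    to the tail of [q] in [j] under [phi] and next to the head of [q] in [k] under [psi]. This is 4T
    with [q] as the arrow [a] and [p] as [b]. *)
Lemma cl_strands_4T c phi psi s p q t : has_holes 3 c ->
    phi p = x -> psi p = y -> phi q = z -> {in predC1 p, psi =1 phi} ->
    p \notin s -> p \notin t -> 
  cl n (plug c (strands phi (s ++ [:: p, q & t])))
    + cl n (plug c (strands psi (s ++ [:: p, q & t])))
  = cl n (plug c (strands phi (s ++ [:: q, p & t])))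
    + cl n (plug c (strands psi (s ++ [:: q, p & t]))).
Proof.
move=> hc px py qz e ps pt.
have qp : q != p by apply: contraNneq neq_xz => qp; rewrite -px -qp qz.
have qz' : psi q = z by rewrite e.
have es u : p \notin u -> [/\ strand_i psi u = strand_i phi u,
    strand_j psi u = strand_j phi u & strand_k psi u = strand_k phi u].
  move=> pu; have eu : {in u, psi =1 phi}.
    by move=> r ru; apply: e; apply: contraNneq pu => <-.
  have aux f P : [seq f (psi r) r | r <- u & P (psi r)]
      = [seq f (phi r) r | r <- u & P (phi r)] :> seq (letter unit).
    rewrite (@eq_in_filter _ (fun r => P (psi r)) (fun r => P (phi r))); last first.
      by move=> r /eu ->.
    by apply/eq_in_map => r; rewrite mem_filter => /andP[_ /eu ->].
  split.
  - exact: (aux (fun _ r => tl (r, tt)) (fun i => (i == x) || (i == y))).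
  - exact: (aux (fun i r => ((r, tt), i == x)) (fun i => (i == x) || (i == z))).
  - exact: (aux (fun _ r => hd (r, tt)) (fun i => (i == y) || (i == z))).
have [[si sj sk] [ti tj tk]] := (es _ ps, es _ pt).
have [//||c' hc' ec] := refill (k' := 2) hc
  (cs := [:: map inl (strand_i phi s ++ tl (p, tt) :: strand_i phi t);
             around (strand_j phi s) 0 (strand_j phi t);
             around (strand_k phi s) 1 (strand_k phi t)]).
  by rewrite !map_cons !holes_around holes_inl.
have [nyx nzx nzy] : [/\ y == x = false, z == x = false & z == y = false].
  by rewrite ![_ == x]eq_sym [z == y]eq_sym (negPf neq_xy) (negPf neq_xz) (negPf neq_yz).
have := cl_4T n (q, tt) (p, tt) hc'; rewrite !ec !map_cons !plug_around !plug_inl /=.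
rewrite -![_ :: _ :: t]/([:: _; _] ++ t) !strands_cat si sj sk ti tj tk.
rewrite /strand_i /strand_j /strand_k /= px py qz qz'.
rewrite !(eqxx, nyx, nzx, nzy, negPf neq_xy, negPf neq_xz, negPf neq_yz) /=.
by rewrite px qz qz' eqxx nzx.
Qed.

(** Attaching all copies of [z] last gives one side of R3, attaching them first gives the other.
    Thus R3 becomes the exchange of two blocks in the list of positions. *)
Lemma strands_split phi (s := [seq p <- iota 0 n | phi p != z])
    (t := [seq p <- iota 0 n | phi p == z]) :
  [/\ strand_i phi s = map (@tl unit) (copies n phi (predU (pred1 x) (pred1 y))),
      strand_j phi s = map (@hd unit) (copies n phi (pred1 x)) &
      strand_k phi s = map (@hd unit) (copies n phi (pred1 y))] /\
  [/\ strand_i phi t = [::],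
      strand_j phi t = map (@tl unit) (copies n phi (pred1 z)) &
      strand_k phi t = map (@hd unit) (copies n phi (pred1 z))].
Proof.
have aux (P Q Q' : pred nat) (f : nat -> bool) b :
    (forall i, P i && Q i = Q' i) -> (forall i, Q' i -> f i = b) ->
  [seq ((p, tt), f (phi p)) | p <- [seq p <- iota 0 n | Q (phi p)] & P (phi p)]
    = [seq (a, b) | a <- copies n phi Q'] :> seq (letter unit).
  move=> PQ fb; rewrite -filter_predI /copies -map_comp.
  rewrite (@eq_filter _ _ (fun p => Q' (phi p))) => [|p]; last exact: PQ.
  by apply/eq_in_map => p; rewrite mem_filter => /andP[/fb <-].
have [nxz nyz] := (negPf neq_xz, negPf neq_yz).
split; split.
- apply: (aux (predU (pred1 x) (pred1 y)) (predC1 z) _ (fun=> false)) => // i /=.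
  by case: (eqVneq i x) => [->|_]; rewrite ?nxz //; case: (eqVneq i y) => // ->; rewrite nyz.
- apply: (aux (predU (pred1 x) (pred1 z)) (predC1 z) _ (eq_op^~ x)) => [i|i /eqP ->] /=.
    case: (eqVneq i x) => [->|_]; rewrite ?nxz //; exact: andbN.
  by rewrite eqxx.
- apply: (aux (predU (pred1 y) (pred1 z)) (predC1 z) _ (fun=> true)) => // i /=.
  case: (eqVneq i y) => [->|_]; rewrite ?nyz //; exact: andbN.
- have -> : [::] = [seq (a, false) | a <- copies n phi pred0].
    by rewrite /copies (@eq_filter _ _ pred0) // filter_pred0.
  apply: (aux (predU (pred1 x) (pred1 y)) (pred1 z) _ (fun=> false)) => // i /=.
  by case: (eqVneq i z) => [->|_]; rewrite ?andbF // ![z == _]eq_sym nxz nyz.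
- apply: (aux (predU (pred1 x) (pred1 z)) (pred1 z) _ (eq_op^~ x)) => [i|i /eqP ->] /=.
    by case: (eqVneq i z); rewrite ?orbT ?andbF.
  by rewrite eq_sym nxz.
- apply: (aux (predU (pred1 y) (pred1 z)) (pred1 z) _ (fun=> true)) => // i /=.
  by case: (eqVneq i z); rewrite ?orbT ?andbF.
Qed.

Variables (c : context bool) (A : seq (arrow bool)).
Hypotheses (hc : has_holes 3 c).
Hypotheses (nx : {in inls c, forall l, l.1.1 != x})
  (ny : {in inls c, forall l, l.1.1 != y}).

Definition swap_xy i := if i == x then y else if i == y then x else i.

Lemma swap_xy_id m i : m != x -> m != y -> (swap_xy i == m) = (i == m).
Proof.
move=> mx my; rewrite /swap_xy; case: (eqVneq i x) => [->|_].
  by rewrite eq_sym (negPf my) eq_sym (negPf mx).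
by case: (eqVneq i y) => // ->; rewrite eq_sym (negPf mx) eq_sym (negPf my).
Qed.

(** The set of positions that are copies of [z]. Exchanging [x] and [y] at a position preserves it,
    so the sum splits by tag into parts on which one order of attachment can be used for all maps
    and on which the pairing of maps acts. *)
Definition tag (s : seq (arrow bool)) : n.-tuple bool :=
  [tuple named s p == z | p < n].

Lemma nth_tag s p : (p < n)%N -> nth false (tag s) p = (named s p == z).
Proof. by move=> lt; rewrite -[p]/(nat_of_ord (Ordinal lt)) nth_mktuple. Qed.

Definition tagsum (t : n.-tuple bool) (L : seq nat) : Asw_deg n :=
  \sum_(s <- words n A | tag s == t)
     weight s *: cl n (plug (expandc n (named s) c) (strands (named s) L)).

(* 4T applies to the sum of two terms: one where the [p]-th arrow is a copy of
   [x], and one where it is a copy of [y].  They are paired by an involution of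
   the index set, so twice the sum is unchanged. *)
Lemma tagsum_swap (t : n.-tuple bool) u p q v :
    perm_eq (map (fun a => (swap_xy a.1, a.2)) A) A ->
    perm_eq (u ++ [:: p, q & v]) (iota 0 n) ->
    ~~ nth false t p -> nth false t q ->
  tagsum t (u ++ [:: p, q & v]) = tagsum t (u ++ [:: q, p & v]).
Proof.
move=> pA pn tp tq; set L := u ++ _; set L' := u ++ _.
pose up := update (fun a : arrow bool => (swap_xy a.1, a.2)) p.
have eup (s : seq (arrow bool)) r m : m != x -> m != y ->
    (named (up s) r == m) = (named s r == m).
  by move=> mx my; rewrite named_update; case: ifP => // /andP[/eqP -> _]; rewrite swap_xy_id.
have [nzx nzy] : z != x /\ z != y by rewrite ![z == _]eq_sym.
have tag_up s : tag (up s) = tag s by apply: eq_mktuple => r; rewrite eup.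
have expandc_up s : expandc n (named (up s)) c = expandc n (named s) c.
  by apply: eq_expandc => l lc r _; apply: eup; [apply: nx|apply: ny].
have lt_n r : r \in L -> (r < n)%N by rewrite (perm_mem pn) mem_iota.
have [pn' qn'] : (p < n)%N /\ (q < n)%N.
  by split; apply: lt_n; rewrite /L mem_cat !inE eqxx ?orbT.
have : uniq L by rewrite (perm_uniq pn) iota_uniq.
rewrite cat_uniq /= !inE !negb_or => /and3P[_ /andP[pu _] /and3P[/andP[pq pv] _ _]].
have double B : tagsum t B + tagsum t B = \sum_(s <- words n A | tag s == t) weight s *:
    (cl n (plug (expandc n (named s) c) (strands (named s) B))
       + cl n (plug (expandc n (named s) c) (strands (named (up s)) B))).
  rewrite {2}/tagsum (big_words_update n p _ _ pA) -/up.
  rewrite (eq_bigl (fun s => tag s == t)) => [|s]; last by rewrite tag_up.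
  rewrite /tagsum -big_split; apply: eq_bigr => s _.
  by rewrite weight_update expandc_up scalerDr.
suff e : tagsum t L + tagsum t L = tagsum t L' + tagsum t L'.
  have two : (2%:R : rat) != 0 by [].
  by apply: (scalerI two); rewrite !scaler_nat !mulr2n.
rewrite !double big_seq_cond [RHS]big_seq_cond; apply: eq_bigr => s.
rewrite mem_words => /andP[/andP[/eqP sz _] /eqP ts]; congr (_ *: _).
have qz : named s q = z by apply/eqP; rewrite -nth_tag // ts.
have pz : named s p != z by rewrite -nth_tag // ts.
have hc' := has_holes_expandc n (named s) hc.
have up_p : named (up s) p = swap_xy (named s p) by rewrite named_update eqxx sz pn'.
have up_r : {in predC1 p, named (up s) =1 named s}.
  by move=> r; rewrite inE => /negPf rp; rewrite named_update rp.
case: (eqVneq (named s p) x) => [px|px].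
  by apply: cl_strands_4T => //; rewrite up_p px /swap_xy eqxx.
case: (eqVneq (named s p) y) => [py|py].
  rewrite addrC [RHS]addrC; apply: cl_strands_4T => //.
  - by rewrite up_p py /swap_xy eqxx eq_sym (negPf neq_xy).
  - by rewrite up_r // inE eq_sym.
  - by move=> r rp; rewrite up_r.
(* Here the arrow at [p] is none of the three, so [p] does not occur in the strands and its place in
   the list is immaterial. *)
have es B : strands (named s) (u ++ [:: p, q & B])
    = strands (named s) (u ++ [:: q, p & B]).
  rewrite -![_ :: _ :: B]/([:: _; _] ++ B) !strands_cat /strand_i /strand_j /strand_k /=.
  by rewrite (negPf px) (negPf py) (negPf pz).
congr (cl n (plug _ _) + cl n (plug _ _)); first exact: es.
suff eu : named (up s) =1 named s.
  rewrite (_ : named (up s) = named s); first exact: es.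
  exact/boolp.funext.
move=> r; case: (eqVneq r p) => [->|]; last exact: up_r.
by rewrite up_p /swap_xy (negPf px) (negPf py).
Qed.

End R3.

(** On each tag class the two sides are [tagsum] for the copies of [jk] listed last and first;
    [block_swap] passes between them by the 4T swaps of [tagsum_swap]. *)
Lemma zsum_R3 n c ij ik jk : has_holes 3 c ->
    ij.2 = true -> ik.2 = true -> jk.2 = true ->
    wf (plug c [:: [:: tl ij; tl ik]; [:: hd ij; tl jk]; [:: hd ik; hd jk]]) ->
  zsum n (plug c [:: [:: tl ij; tl ik]; [:: hd ij; tl jk]; [:: hd ik; hd jk]])
    = zsum n (plug c [:: [:: tl ik; tl ij]; [:: tl jk; hd ij]; [:: hd jk; hd ik]]).
Proof.
case: ij ik jk => [x []] [y []] [z []] //= hc _ _ _.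
set ij := (x, true); set ik := (y, true); set jk := (z, true).
set w := plug _ _; set w' := plug _ _ => ww.
have [//|/= + fresh] := wf_plug hc _ ww.
rewrite !inE !xpair_eqE /= !andbT !andbF /= !orbF !negb_or.
case/and4P=> /andP[neq_xy neq_xz] neq_yz _ _.
have nx : {in inls c, forall l, l.1.1 != x} by apply: (fresh ij); rewrite !inE eqxx ?orbT.
have ny : {in inls c, forall l, l.1.1 != y} by apply: (fresh ik); rewrite !inE eqxx ?orbT.
set A := tails w.
(* Exchanging the names [x] and [y] keeps the signs; it permutes the arrows because [ij] and [ik]
   are both positive. *)
have pA : perm_eq (map (fun a => (swap_xy x y a.1, a.2)) A) A.
  have pw : perm_eq w ([:: tl ij; tl ik; tl jk; hd ij; hd ik; hd jk] ++ inls c).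
    rewrite (permPl (has_holes_plug hc _)) // perm_catC perm_cat2r /= !perm_cons.
    exact: (permEl (perm_catCA [:: _] [:: _] _)).
  have pt : perm_eq A [:: ij, ik, jk & tails (inls c)] by apply: tails_perm pw.
  rewrite (permPl (perm_map _ pt)) (permPr pt) /= /swap_xy !eqxx.
  rewrite [y == x]eq_sym (negPf neq_xy) ![z == _]eq_sym (negPf neq_xz) (negPf neq_yz).
  rewrite (permPl (permEl (perm_catCA [:: _] [:: _] _))) /= !perm_cons.
  rewrite map_id_in // => -[i s]; rewrite mem_tails => lc /=.
  by rewrite (negPf (nx _ lc)) (negPf (ny _ lc)).
have split_tag F : \sum_(s <- words n A) F s
    = \sum_(t : n.-tuple bool) \sum_(s <- words n A | tag n z s == t) F s :> Asw_deg n.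
  exact: (partition_big (tag n z) xpredT).
(* On interval [i], the expansion lists the copies of one arrow before those of the other, the
   strands list them by position; TC identifies the two. *)
have holes_i phi b1 b2 : has_holes 3 (expandc n phi c) -> [:: b1; b2] = [:: ij; ik] \/
    [:: b1; b2] = [:: ik; ij] -> forall h k,
    cl n (plug (expandc n phi c) [:: expand n phi [:: tl b1; tl b2]; h; k])
  = cl n (plug (expandc n phi c)
      [:: map (@tl unit) (copies n phi (predU (pred1 x) (pred1 y))); h; k]).
  move=> hc' eb h k; rewrite (_ : expand n phi _ = map (@tl unit)
    (copies n phi (pred1 b1.1) ++ copies n phi (pred1 b2.1))); last first.
    by rewrite /expand /= cats0 map_cat.
  apply: (cl_plug_tails n hc') => //.
  have pxy : perm_eq (copies n phi (pred1 x) ++ copies n phi (pred1 y))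
      (copies n phi (predU (pred1 x) (pred1 y))).
    by apply: copies_predU => i; apply/negP => /= /andP[/eqP -> /eqP/eqP]; apply/negP.
  by case: eb => -[-> ->]; rewrite // perm_catC.
have filter_tag s : [seq p <- iota 0 n | nth false (tag n z s) p]
      = [seq p <- iota 0 n | named s p == z]
    /\ [seq p <- iota 0 n | ~~ nth false (tag n z s) p]
      = [seq p <- iota 0 n | named s p != z].
  by split; apply: eq_in_filter => p; rewrite mem_iota => lt; rewrite nth_tag.
have zw : zsum n w = \sum_(t : n.-tuple bool) tagsum x y z c A t
    ([seq p <- iota 0 n | ~~ nth false t p] ++ [seq p <- iota 0 n | nth false t p]).
  rewrite /zsum split_tag; apply: eq_bigr => t _; apply: eq_bigr => s /eqP <-.
  congr (_ *: _); rewrite expand_plug !map_cons holes_i; [|exact: has_holes_expandc|by left].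
  have [-> ->] := filter_tag s.
  have [[ei ej ek] [fi fj fk]] := strands_split n neq_xz neq_yz (named s).
  rewrite -[X in strands _ _ _ _ (_ ++ X)]cat0s -[X in _ ++ X]cats0.
  by rewrite strands_cat ei ej ek fi fj fk /expand /= !cats0.
have zw' : zsum n w' = \sum_(t : n.-tuple bool) tagsum x y z c A t
    ([seq p <- iota 0 n | nth false t p] ++ [seq p <- iota 0 n | ~~ nth false t p]).
  have pA' : perm_eq (tails w') A.
    apply: tails_perm; apply: (perm_plug hc) => //; apply/permP => P /=.
    rewrite !addn0 addnCA; congr (_ + (_ + _))%N.
    by rewrite addnCA; congr (_ + (_ + _))%N; rewrite addnC.
  rewrite /zsum (perm_big _ (words_perm n pA')) split_tag.
  apply: eq_bigr => t _; apply: eq_bigr => s /eqP <-.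
  congr (_ *: _); rewrite expand_plug !map_cons holes_i; [|exact: has_holes_expandc|by right].
  have [-> ->] := filter_tag s.
  have [[ei ej ek] [fi fj fk]] := strands_split n neq_xz neq_yz (named s).
  rewrite -[X in strands _ _ _ _ (_ ++ X)]cats0.
  by rewrite strands_cat ei ej ek fi fj fk /expand /= !cats0.
rewrite zw zw'; apply: eq_bigr => t _.
apply: (block_swap (P := nth false t)).
- exact: filter_all.
- exact: filter_all.
move=> u p q v e tp tq; apply: tagsum_swap => //.
by rewrite (permPl e) perm_catC; apply/permEl/perm_filterC.
Qed.

(** * The invariant on w-knots *)

Lemma zsum_wmove n (D E : gauss) : wmove D E -> zsum n (word D) = zsum n (word E).
Proof.
have wD : wf (word D) := valP D.
case=> [f fi|c a hc eD|c a b hc ab eD|c a b hc ab eD|c a b d hc pa pb pd eD|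
  c a b hc eD] eE;
  rewrite ?eD eE.
- by rewrite zsum_rename.
- exact: zsum_R1s.
- by rewrite eD in wD; apply: (zsum_R2 n (h := [:: a; b]) hc ab).
- rewrite eD in wD; apply: (zsum_R2 n (h := [:: b; a]) hc ab) => //.
  exact: (permEl (perm_catC [:: _] [:: _])).
- by rewrite eD in wD; apply: zsum_R3.
- exact: zsum_OC.
Qed.

Definition Zexp (k : wknot) : Asw := fun n => (n`!%:R)^-1 *: zsum n (word (repr k)).

Lemma Zexp_knot D n : Zexp (knot D) n = (n`!%:R)^-1 *: zsum n (word D).
Proof.
have /eqmodP/asboolP e : \pi_wknot (repr (knot D)) = \pi_wknot D by rewrite reprK.
rewrite /Zexp; congr (_ *: _); move: (repr _) e => E e.
by elim: e => [? ? /zsum_wmove->|//|? ? _ ->|? ? ? _ -> _ ->].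
Qed.

(** * The leading term *)

Lemma extend_resolution m (K : singular m) n : extend Zexp (resolution K) n =
  \sum_(b : m.-tuple bool)
    \prod_(p <- zip (semivs (val K)) b) (if p.1.2.1 == p.2 then 1 else -1 : rat)
     *: Zexp (knot (resolve (val K) (mask b (semivs (val K))))) n.
Proof.
have liftB := lift_is_additive (fun k => Zexp k n).
have lift0 : fglift (fun k => Zexp k n) 0 = 0 by rewrite -(subrr 0) liftB subrr.
have liftD x y : fglift (fun k => Zexp k n) (x + y)
    = fglift (fun k => Zexp k n) x + fglift (fun k => Zexp k n) y.
  by rewrite -[y in LHS]opprK liftB -[- y]sub0r liftB lift0 sub0r opprK.
rewrite /extend /resolution (big_morph _ liftD lift0).
by apply: eq_bigr => b _; rewrite liftU.
Qed.

Lemma uniq_map_inj (T U : eqType) (f : T -> U) (s : seq T) :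
  uniq (map f s) -> {in s &, injective f}.
Proof.
elim: s => //= x s IH /andP[nx us] y z; rewrite !inE.
case/predU1P=> [->|ys] /predU1P[->|zs] // e; last exact: IH.
- by case/negP: nx; rewrite e map_f.
- by case/negP: nx; rewrite -e map_f.
Qed.

Section Restriction.
Variables (X Y : choiceType) (p : pred (arrow X)) (g : X -> Y) (w : seq (letter X)).

Lemma mem_wf_tails l : wf w -> l \in w -> l.1 \in tails w.
Proof.
case/andP=> _ e; case: l => [a []] /= lw; last by rewrite mem_tails.
by rewrite (perm_mem e) mem_heads.
Qed.

(** An arrow outside the image of the map has no copies, so deleting it does not change the
    expansion. *)
Lemma expand_restrict n (s : seq (arrow X)) : wf w ->
    {subset s <= tails w} -> all p s -> size s = n ->
  expand n (named s) (restrict p g w) = expand n (named s) w.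
Proof.
move=> ww sA /allP ps sz.
have {ww} : {in w, forall l, ~~ p l.1 -> cable n (named s) l = [::]}.
  move=> l lw npl; rewrite /cable /copies (_ : filter _ _ = [::]) //.
  apply/eqP; rewrite -[_ == _]negbK -has_filter; apply/hasPn => i; rewrite mem_iota => /= lt.
  apply: contra npl; rewrite /named (nth_map l.1) ?sz // => /eqP e.
  have si : nth l.1 s i \in s by rewrite mem_nth ?sz.
  suff <- : nth l.1 s i = l.1 by apply: ps.
  (* The map is read through names only, and names determine the arrows of a well-formed word. *)
  by apply: (uniq_map_inj (andP ww).1) => //; [apply: sA|apply: mem_wf_tails].
elim: w => //= l v IH nil_p; rewrite /restrict /=; case: ifP => pl.
  by rewrite /expand /= -!/(expand _ _ _) -IH // => k kv; apply: nil_p; rewrite inE kv orbT.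
rewrite [RHS]/expand /= -/(expand _ _ _) nil_p ?mem_head ?pl //.
by apply: IH => k kv; apply: nil_p; rewrite inE kv orbT.
Qed.
End Restriction.

(** Writing each resolution as a subsum over maps into the arrows of the singular diagram itself
    gives all resolutions a common index set and common terms. *)
Lemma zsum_resolve n (K : diag (bool * bool)%type) S :
  zsum n (word (resolve K S)) =
  \sum_(s <- words n (tails (word K)) | all (fun a => ~~ semiv a || (a \in S)) s)
    \prod_(a <- s) (if a.2.1 then 1 else -1 : rat) *: cl n (expand n (named s) (word K)).
Proof.
set p := fun a => ~~ semiv a || (a \in S); pose A := tails (word K).
have wK : wf (word K) := valP K.
rewrite /zsum {1}/word /= tails_restrict -/p words_map words_filter big_map big_filter.
rewrite big_seq_cond [RHS]big_seq_cond; apply: eq_bigr => s.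
rewrite mem_words => /andP[/andP[/eqP sz /allP sA] ps].
rewrite /weight big_map; congr (_ *: cl n _).
rewrite (_ : named (map _ s) = named s); last by rewrite /named /unzip1 -map_comp.
exact: expand_restrict.
Qed.

Lemma big_tuple_words (m : nat) (V : nmodType) (F : seq bool -> V) :
  \sum_(b : m.-tuple bool) F b = \sum_(s <- words m [:: true; false]) F s.
Proof.
rewrite -(big_map (@tval m bool) xpredT F); apply: perm_big; apply: uniq_perm.
- by rewrite map_inj_uniq ?index_enum_uniq //; apply: val_inj.
- exact: words_uniq.
move=> s; rewrite mem_words; apply/mapP/andP => [[b _ ->]|[sz _]].
  by split; [rewrite size_tuple|apply/allP => -[]; rewrite !inE].
by exists (Tuple sz); rewrite ?mem_index_enum.
Qed.

Lemma sum_prod_zip (T : eqType) (S : seq T) (F : (T * bool)%type -> rat) :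
  \sum_(s <- words (size S) [:: true; false]) \prod_(p <- zip S s) F p
    = \prod_(a <- S) (F (a, true) + F (a, false)).
Proof.
elim: S => [|a S IH]; first by rewrite /= big_seq1 !big_nil.
rewrite [size _]/= wordsS big_allpairs_dep /= !big_cons big_nil addr0.
under eq_bigr do rewrite big_cons.
under [X in _ + X]eq_bigr do rewrite big_cons.
by rewrite -!big_distrr /= IH mulrDl.
Qed.

Definition sgn (a : arrow (bool * bool)%type) : rat := if a.2.1 then 1 else -1.

Lemma leading_coef (S s : seq (arrow (bool * bool)%type)) : uniq S -> all semiv S ->
    {subset filter semiv s <= S} ->
  \sum_(b : (size S).-tuple bool | all (fun a => ~~ semiv a || (a \in mask b S)) s)
     \prod_(p <- zip S b) (if p.1.2.1 == p.2 then 1 else -1 : rat)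
  = \prod_(a <- S) (if a \in s then sgn a else 0).
Proof.
move=> uS /allP vS sS.
(* The condition that used arrows are kept is moved into the factors: a used arrow that is removed
   contributes [0]. *)
pose F (p : (arrow (bool * bool) * bool)%type) : rat :=
  if (p.1 \in s) ==> p.2 then (if p.1.2.1 == p.2 then 1 else -1) else 0.
have FE r : \prod_(p <- r) F p = if all (fun p => (p.1 \in s) ==> p.2) r
    then \prod_(p <- r) (if p.1.2.1 == p.2 then 1 else -1) else 0.
  elim: r => [|p r IH]; first by rewrite !big_nil.
  rewrite !big_cons IH /F /=; case: (_ ==> _) => /=; last by rewrite mul0r.
  by case: (all _ r); rewrite ?mulr0.
rewrite big_mkcond.
transitivity (\sum_(b : (size S).-tuple bool) \prod_(p <- zip S b) F p).
  apply: eq_bigr => b _; rewrite FE; congr (if _ then _ else _).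
  have sb : size b = size S by rewrite size_tuple.
  apply/allP/(all_nthP ((0%N, (true, true)), true)) => [h i|h a sa].
    rewrite size_zip sb minnn => lt; rewrite nth_zip //=; apply/implyP => /h.
    rewrite (vS _ (mem_nth _ lt)) /= in_mask // index_uniq //.
    by rewrite (set_nth_default false) ?sb // => /andP[].
  case va: (semiv a) => //=; have aS : a \in S by apply: sS; rewrite mem_filter va.
  rewrite in_mask // aS /=.
  have /h : (index a S < size (zip S b))%N by rewrite size_zip sb minnn index_mem.
  rewrite nth_zip //= nth_index // sa /=.
  by rewrite (set_nth_default false) // sb index_mem.
rewrite (big_tuple_words _ (fun b => \prod_(p <- zip S b) F p)) sum_prod_zip.
apply: eq_bigr => a _; rewrite /F /sgn /= implybT implybF.
by case: (a \in s); case: a.2.1; rewrite /= ?addr0 ?subrr ?addNr.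
Qed.

(** Such an [s] hits each semi-virtual arrow exactly once and no other arrow, so the expansion is
    the underlying diagram with each arrow renamed to its position in [s]. *)
Lemma cl_underlying (m : nat) (K : singular m) (s : seq (arrow (bool * bool)%type)) :
  perm_eq s (semivs (val K)) ->
  cl m (expand m (named s) (word (val K))) = aclass (underlying K).
Proof.
move=> sS; set w := word (val K); have ww : wf w := valP (val K).
have sz : size s = m by rewrite (perm_size sS); apply/eqP/(valP K).
have sA : {subset s <= tails w} by move=> a; rewrite (perm_mem sS) mem_filter => /andP[].
have vs : all semiv s by apply/allP => a; rewrite (perm_mem sS) mem_filter => /andP[].
rewrite -(expand_restrict (fun=> tt) ww sA vs sz) -cl_aword.
set v := restrict _ _ w; rewrite [aword _](_ : _ = v) //.
have us : uniq (unzip1 s).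
  rewrite (perm_uniq (perm_map fst sS)); apply: subseq_uniq (andP ww).1.
  exact/map_subseq/filter_subseq.
have vs' : {subset names v <= unzip1 s}.
  move=> _ /mapP[l /mapP[k + ->] ->]; rewrite mem_filter /= => /andP[vk kw].
  by apply: map_f; rewrite (perm_mem sS) mem_filter vk mem_wf_tails.
rewrite -(@cl_rename m (index^~ (unzip1 s)) v); last first.
  move=> i j /vs' si /vs' sj e.
  by rewrite -(nth_index 0%N si) e nth_index.
congr cl; rewrite /expand /rename.
elim: v vs' => //= -[[i []] b] v IH vs'; rewrite IH; last first.
  by move=> k kv; apply: vs'; rewrite inE kv orbT.
rewrite -cat1s; congr (_ ++ _); rewrite /cable /copies /=.
have si : i \in unzip1 s by apply: vs'; rewrite inE eqxx.
have lt : (index i (unzip1 s) < m)%N by rewrite -sz -(size_map fst) index_mem.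
rewrite (@eq_in_filter _ _ (pred1 (index i (unzip1 s)))).
  by rewrite filter_pred1_uniq ?iota_uniq ?mem_iota.
move=> p; rewrite mem_iota => /= ltp; rewrite /named -{1}(nth_index 0%N si) nth_uniq //.
  by rewrite size_map sz.
by rewrite size_map sz.
Qed.

(** * The expansion property *)

Theorem theorem3p10 :
  exists Z : wknot -> Asw,
    forall (m : nat) (K : singular m),
      (forall n : nat, (n < m)%N -> extend Z (resolution K) n = 0) /\
      extend Z (resolution K) m = aclass (underlying K).
Proof.
exists Zexp => m K; set w := word (val K); pose S := semivs (val K).
have szS : size S = m by apply/eqP/(valP K).
have ww : wf w := valP (val K).
have uA : uniq (tails w) := map_uniq (andP ww).1.
have uS : uniq S by apply: filter_uniq.
have vS : all semiv S by apply: filter_all.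
(* Exchanging the sums over resolutions and over maps collects, for each map [s], the coefficient
   computed in [leading_coef]. *)
have expansion n : extend Zexp (resolution K) n = (n`!%:R)^-1 *:
    \sum_(s <- words n (tails w)) ((\prod_(a <- S) (if a \in s then sgn a else 0))
      * \prod_(a <- s) sgn a) *: cl n (expand n (named s) w).
  rewrite extend_resolution.
  under eq_bigr do rewrite Zexp_knot scalerA mulrC -scalerA zsum_resolve scaler_sumr.
  rewrite -scaler_sumr; congr (_ *: _).
  under eq_bigr do rewrite big_mkcond.
  rewrite exchange_big /= big_seq [RHS]big_seq; apply: eq_bigr => s.
  rewrite mem_words => /andP[_ /allP sA].
  rewrite -leading_coef // => [|a]; last first.
    by rewrite !mem_filter => /andP[-> /sA].
  rewrite -big_mkcond /= -scalerA scaler_suml szS.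
  by [].
(* A nonzero coefficient requires [s] to use all [m] semi-virtual arrows, so such terms start in
   degree [m]. *)
have sub n s : s \in words n (tails w) -> all (mem s) S -> (m <= n)%N.
  rewrite mem_words => /andP[/eqP <- _] /allP Ss.
  by rewrite -szS; apply: uniq_leq_size.
have coef0 s : ~~ all (mem s) S -> \prod_(a <- S) (if a \in s then sgn a else 0) = 0.
  move=> /allPn[a aS /negPf nas]; apply/eqP; rewrite prodf_seq_eq0.
  by apply/hasP; exists a => //=; rewrite -[mem s a]/(a \in s) in nas; rewrite nas.
split=> [n lt|].
  rewrite expansion big_seq big1 ?scaler0 // => s sw.
  rewrite coef0 ?mul0r ?scale0r //; apply/negP => /(sub _ _ sw).
  by rewrite leqNgt lt.
have permS s : s \in words m (tails w) -> all (mem s) S = perm_eq s S.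
  rewrite mem_words => /andP[/eqP sz _]; apply/allP/idP => [Ss|e a]; last first.
    by rewrite -(perm_mem e).
  have [ssz eS] := uniq_min_size uS Ss (eq_leq (etrans sz (esym szS))).
  by apply: uniq_perm => //; apply: (leq_size_uniq uS Ss); rewrite sz szS.
(* One product of signs comes from the resolution, the other from the weight of the map; for a
   negative arrow, 1 - exp(-a) again starts with +a. *)
have sgn2 : (\prod_(a <- S) sgn a) * (\prod_(a <- S) sgn a) = 1.
  rewrite -big_split /= big1 // => a _; rewrite /sgn.
  by case: ifP; rewrite ?mulr1 ?mulrNN ?mulr1.
rewrite expansion.
(* The words that contribute in degree [m] are the [m!] orderings of [S], each giving the underlying
   diagram; this cancels the factor [1/m!]. *)
rewrite (eq_big_seq (fun s => if perm_eq s S then aclass (underlying K) else 0)).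
  rewrite -big_mkcond -big_filter (perm_big (permutations S)).
    rewrite big_const_seq count_predT size_permutations // szS iter_addr_0.
    rewrite -scaler_nat scalerA mulVf ?scale1r // Num.Theory.pnatr_eq0.
    by rewrite -lt0n fact_gt0.
  apply: uniq_perm; rewrite ?permutations_uniq ?filter_uniq ?words_uniq // => s.
  rewrite mem_filter mem_permutations andb_idr // => e.
  rewrite mem_words (perm_size e) szS eqxx /=; apply/allP => a.
  by rewrite (perm_mem e) mem_filter => /andP[].
move=> s sw; case: ifP => [e|/negbT ne]; last by rewrite coef0 ?mul0r ?scale0r ?permS.
rewrite cl_underlying // (perm_big _ e) /= (eq_big_seq sgn) ?sgn2 ?scale1r // => a aS.
by rewrite (perm_mem e) aS.
Qed.
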